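(* Let $R$ be a $\phi$-ring. Then the following assertions are equivalent: (1) $R$ is an integral domain; (2) every nonnil-injective $R$-module is injective; (3) every nonnil-FP-injective $R$-module is FP-injective.
   Context: All rings are commutative with identity and all modules are unitary. $\mathrm{Nil}(R)$ denotes the set of nilpotent elements of $R$. $R$ is a $\phi$-ring if $\mathrm{Nil}(R)$ is a divided prime ideal, i.e. $\mathrm{Nil}(R)$ is a prime ideal and $\mathrm{Nil}(R)\subsetneq (x)$ for every $x\in R\setminus \mathrm{Nil}(R)$. An ideal of $R$ is nonnil if it contains a non-nilpotent element. An $R$-module $T$ is $\phi$-torsion if for every $x\in T$ there is a nonnil ideal $I$ of $R$ with $Ix=0$. An $R$-module $M$ is nonnil-injective if $\operatorname{Ext}^1_R(T,M)=0$ for every $\phi$-torsion $R$-module $T$; it is nonnil-FP-injective if $\operatorname{Ext}^1_R(T,M)=0$ for every finitely presented $\phi$-torsion $R$-module $T$. An $R$-module $M$ is FP-injective if $\operatorname{Ext}^1_R(N,M)=0$ for every finitely presented $R$-module $N$. *)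

(* Defs.v *)
From mathcomp Require Import all_boot all_order all_algebra ring_quotient.
From mathcomp Require Import boolp.

Set Implicit Arguments.
Unset Strict Implicit.
Unset Printing Implicit Defensive.

Import GRing.Theory.
Local Open Scope ring_scope.

Section Ideals.
Variable R : comNzRingType.

Definition nil_ideal : {pred R} := [pred x | `[< exists n, x ^+ n = 0 >]].

Definition principal_ideal (x : R) : {pred R} :=
  [pred y | `[< exists r, y = r * x >]].

(* [idealr_closed] only accepts proper ideals, as required of a prime ideal. *)
Definition prime_ideal (I : {pred R}) : Prop :=
  idealr_closed I /\ prime_idealr_closed I.

Definition phi_ring : Prop :=
  prime_ideal nil_ideal /\
  forall x, x \notin nil_ideal ->
    {subset nil_ideal <= principal_ideal x} /\
    ~ {subset principal_ideal x <= nil_ideal}.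

(* The unit ideal must be allowed here (it is nonnil), so this is
   [submod_closed] on the regular module and not [idealr_closed]. *)
Definition ideal (I : {pred R}) : Prop := submod_closed (I : {pred R^o}).

Definition nonnil_ideal (I : {pred R}) : Prop :=
  ideal I /\ exists2 x, x \in I & x \notin nil_ideal.

End Ideals.

Section Modules.
Variable R : comNzRingType.
Implicit Types M N T P A B C : lmodType R.

Definition surjective A B (f : A -> B) : Prop := forall y, exists x, f x = y.

Definition exact_at A B C (f : {linear A -> B}) (g : {linear B -> C}) : Prop :=
  forall y, g y = 0 <-> exists x, f x = y.

Definition projective P : Prop :=
  forall A B (p : {linear A -> B}) (f : {linear P -> B}),
    surjective p -> exists g : {linear P -> A}, p \o g =1 f.

Definition injective_module M : Prop :=
  forall A B (i : {linear A -> B}) (f : {linear A -> M}),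
    injective i -> exists g : {linear B -> M}, g \o i =1 f.

Definition finitely_presented N : Prop :=
  exists (m n : nat) (d : {linear 'rV[R]_m -> 'rV[R]_n})
         (p : {linear 'rV[R]_n -> N}),
    exact_at d p /\ surjective p.

Record projective_resolution T := ProjectiveResolution {
  pr_mod : nat -> lmodType R;
  pr_diff : forall n, {linear pr_mod n.+1 -> pr_mod n};
  pr_aug : {linear pr_mod 0%N -> T};
  pr_projective : forall n, projective (pr_mod n);
  pr_aug_surj : surjective pr_aug;
  pr_exact0 : exact_at (pr_diff 0%N) pr_aug;
  pr_exactS : forall n, exact_at (pr_diff n.+1) (pr_diff n) }.

(* Vanishing of the cohomology at Hom(P_1, M) of the complex
   Hom(P_0, M) -> Hom(P_1, M) -> Hom(P_2, M). *)
Definition H1_Hom_vanishes T (P : projective_resolution T) M : Prop :=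
  forall f : {linear pr_mod P 1%N -> M},
    (f \o pr_diff P 1%N =1 fun=> 0) ->
    exists g : {linear pr_mod P 0%N -> M}, g \o pr_diff P 0%N =1 f.

(* Ext^1_R(T, M) = 0.  The choice of resolution is immaterial, since
   H^1(Hom(P, M)) does not depend on P up to isomorphism, and free resolutions
   exist for every T. *)
Definition Ext1_vanishes T M : Prop :=
  forall P : projective_resolution T, H1_Hom_vanishes P M.

Definition FP_injective M : Prop :=
  forall N, finitely_presented N -> Ext1_vanishes N M.

Definition phi_torsion T : Prop :=
  forall x : T, exists I : {pred R},
    nonnil_ideal I /\ forall a, a \in I -> a *: x = 0.

Definition nonnil_injective M : Prop :=
  forall T, phi_torsion T -> Ext1_vanishes T M.

Definition nonnil_FP_injective M : Prop :=
  forall T, finitely_presented T -> phi_torsion T -> Ext1_vanishes T M.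

End Modules.

(* Main.v *)
(* Forward direction.  Over a domain, phi-torsion means torsion.  By Baer's
   criterion, injectivity only involves the modules R / I with I <> 0, which are
   torsion.  For the FP version, let K be the kernel of a presentation R^n -> N.
   Choose S maximal among the sets of basis vectors whose span R^S meets K
   trivially: a map K -> M extends by zero to K + R^S, the quotient
   R^n / (K + R^S) is finitely presented and torsion, and therefore the map
   extends to R^n.

   Converse.  Let E be the module of additive maps R / Nil(R) -> Q/Z, so that
   Nil(R) E = 0.  Since every s in Nil(R) is a multiple t x, with t in Nil(R), of
   any given non-nilpotent x, a map into E defined on a submodule K of B with
   B / K phi-torsion is zero on Nil(R) B.  Its composite with evaluation at 1
   extends to an additive map B -> Q/Z, hence E is nonnil-injective.  If n <> 0
   is nilpotent, then Ann(n) + Nil(R) is a proper ideal, so E has a nonzero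
   element z killed by Ann(n); the map nR -> E sending n to z does not extend to
   R because n E = 0.  Thus E is not FP-injective. *)

From HB Require Import structures.
Require Import Defs.
From mathcomp Require Import all_boot all_order all_algebra ring_quotient.
From mathcomp Require Import boolp.
From mathcomp Require classical_sets.
From mathcomp.multinomials Require Import freeg.

Set Implicit Arguments.
Unset Strict Implicit.
Unset Printing Implicit Defensive.

Import GRing.Theory.
Local Open Scope ring_scope.

(** * Partial linear maps, and Ext^1 as an extension problem *)

Section PartialLinear.
Variable R : comNzRingType.
Implicit Types A B C M T : lmodType R.

(* A linear map from a submodule of [A] to [B], given by its graph. *)
Definition partial_linear A B (Q : A -> B -> Prop) : Prop :=
  [/\ Q 0 0,
      forall a x y x' y', Q x y -> Q x' y' -> Q (a *: x + x') (a *: y + y') &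
      forall y, Q 0 y -> y = 0].

Lemma partial_linearZ A B (Q : A -> B -> Prop) a x y :
  partial_linear Q -> Q x y -> Q (a *: x) (a *: y).
Proof. by case=> Q0 QL _ Qxy; have := QL a _ _ _ _ Qxy Q0; rewrite !addr0. Qed.

Lemma partial_linearD A B (Q : A -> B -> Prop) x y x' y' :
  partial_linear Q -> Q x y -> Q x' y' -> Q (x + x') (y + y').
Proof. by case=> _ QL _ Qx Qx'; have := QL 1 _ _ _ _ Qx Qx'; rewrite !scale1r. Qed.

Lemma partial_linearB A B (Q : A -> B -> Prop) x y x' y' :
  partial_linear Q -> Q x y -> Q x' y' -> Q (x - x') (y - y').
Proof.
move=> QP Qx Qx'; apply: partial_linearD => //.
by rewrite -!scaleN1r; apply: partial_linearZ.
Qed.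

Lemma partial_linear_fun A B (Q : A -> B -> Prop) x y y' :
  partial_linear Q -> Q x y -> Q x y' -> y = y'.
Proof.
move=> QP Qx Qx'; apply/eqP; rewrite -subr_eq0; apply/eqP.
by have := partial_linearB QP Qx Qx'; rewrite subrr; case: QP => _ _; apply.
Qed.

Lemma linear_exists A B (f : A -> B) : linear f -> exists g : {linear A -> B}, g =1 f.
Proof.
move=> fL; pose L := GRing.isLinear.Build R A B _ f fL.
by exists (HB.pack_for {linear A -> B} f L).
Qed.

Lemma partial_linear_total A B (Q : A -> B -> Prop) :
  partial_linear Q -> (forall x, exists y, Q x y) ->
  exists f : {linear A -> B}, forall x, Q x (f x).
Proof.
move=> QP /choice[f Qf].
suff /linear_exists[g gf] : linear f by exists g => x; rewrite gf.
by move=> a x y; apply: (partial_linear_fun QP (Qf _)); case: QP => _ + _; apply.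
Qed.

Definition submodule A (W : A -> Prop) : Prop :=
  W 0 /\ forall a x y, W x -> W y -> W (a *: x + y).

Definition extends A B (Q : A -> B -> Prop) (g : A -> B) : Prop :=
  forall x y, Q x y -> y = g x.

(** Surjectivity of the restriction Hom(B, M) -> Hom(ker p, M), a map on ker p being given by a
    graph with that exact domain. For [B] projective and [p] surjective it expresses Ext^1(T, M) =
    0. *)
Definition kernel_extends B T (p : {linear B -> T}) M : Prop :=
  forall Q : B -> M -> Prop, partial_linear Q ->
    (forall x, (exists y, Q x y) <-> p x = 0) ->
    exists g : {linear B -> M}, extends Q g.

(** By exactness, a cocycle on [pr_mod P 1] kills the kernel of [pr_diff P 0], so it amounts to a
    map on the image of [pr_diff P 0], which is the kernel of the augmentation. *)
Lemma H1_Hom_vanishesP T (P : projective_resolution T) M :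
  H1_Hom_vanishes P M <-> kernel_extends (pr_aug P) M.
Proof.
have ex0 y : pr_aug P y = 0 <-> exists x, pr_diff P 0 x = y by apply: pr_exact0.
have ex1 y : pr_diff P 0 y = 0 <-> exists x, pr_diff P 1 x = y.
  exact: pr_exactS.
split=> [HP Q QP Qdom | HP f fd].
- have dQ x : exists y, Q (pr_diff P 0 x) y.
    by apply/Qdom/ex0; exists x.
  have /partial_linear_total[//|f Qf] :
      partial_linear (fun x => Q (pr_diff P 0 x)).
    case: QP => Q0 QL QF; split; rewrite ?linear0 // => a x y x' y'.
    by rewrite linearP; apply: QL.
  have [x|g gf] := HP f.
    have d0 : pr_diff P 0 (pr_diff P 1 x) = 0 by apply/ex1; exists x.
    by have := Qf (pr_diff P 1 x); rewrite d0; case: QP => _ _; apply.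
  exists g => x y Qxy.
  have /ex0[z zx] : pr_aug P x = 0 by apply/Qdom; exists y.
  rewrite -zx in Qxy *; rewrite -[RHS]/((g \o pr_diff P 0) z) gf.
  exact: (partial_linear_fun QP Qxy).
- pose Q x y := exists2 z, pr_diff P 0 z = x & y = f z.
  have [||g gQ] := HP Q.
  + split=> [|a x y x' y' [z <- ->] [z' <- ->]|y [z /ex1[w <-] ->]].
    * by exists 0; rewrite linear0.
    * by exists (a *: z + z'); rewrite linearP.
    * exact: fd.
  + move=> x; split=> [[y [z <- _]]|/ex0[z zx]].
      by apply/ex0; exists z.
    by exists (f z), z.
  by exists g => z; rewrite /= -(gQ _ (f z)) //; exists z.
Qed.

(** Lift [p'] to [v : B' -> B] over [T]. Pulling [Q] back along [v] gives a map on ker p', which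
    extends to some [g]; then [g] and [Q] glue to a map on B = v(B') + ker p. *)
Lemma kernel_extends_transfer B' B T
    (p' : {linear B' -> T}) (p : {linear B -> T}) M :
  projective B' -> surjective p' -> surjective p ->
  kernel_extends p' M -> kernel_extends p M.
Proof.
move=> B'proj p'S pS Hp' Q QP Qdom; have [v pv] := B'proj _ _ p p' pS.
have {}pv x : p (v x) = p' x by apply: pv.
have [||g gQ] := Hp' (fun x => Q (v x)).
- case: QP => Q0 QL QF; split; rewrite ?linear0 // => a x y x' y'.
  by rewrite linearP; apply: QL.
- by move=> x; rewrite -pv.
pose H b y := exists x k m, [/\ b = v x + k, Q k m & y = g x + m].
have HP : partial_linear H.
  have [Q0 QL QF] := QP; split.
  - by exists 0, 0, 0; rewrite !linear0 !addr0.
  - move=> a b y b' y' [x [k [m [-> Qk ->]]]] [x' [k' [m' [-> Qk' ->]]]].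
    exists (a *: x + x'), (a *: k + k'), (a *: m + m').
    by rewrite !linearP !scalerDr (addrACA (a *: v x)) (addrACA (a *: g x));
      split=> //; apply: QL.
  (* The gluing is well defined: if v x + k = 0, then [Q] sends v x to - m, and so g x = - m. *)
  - move=> y [x [k [m [/esym/eqP + Qk ->]]]]; rewrite addrC addr_eq0 => /eqP kE.
    have := partial_linearZ (-1) QP Qk; rewrite kE !scaleN1r opprK => /gQ <-.
    by rewrite addNr.
have [b|h Hh] := partial_linear_total HP.
  have [x xb] := p'S (p b).
  have /Qdom[m Qm] : p (b - v x) = 0 by rewrite linearB /= pv xb subrr.
  by exists (g x + m), x, (b - v x), m; rewrite addrC subrK.
exists h => x y Qx; apply: (partial_linear_fun HP _ (Hh x)).
by exists 0, x, y; rewrite !linear0 !add0r.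
Qed.
End PartialLinear.

(** * Free modules and projective resolutions *)

Section Resolution.
Variable R : comNzRingType.
Implicit Types A B C M T : lmodType R.

Lemma free_lift (K : choiceType) A (f : K -> A) :
  exists g : {linear {freeg K / R} -> A}, forall k, g << k >> = f k.
Proof.
suff /linear_exists[g gf] : linear (fglift f).
  by exists g => k; rewrite gf liftU scale1r.
pose L := GRing.isZmodMorphism.Build _ _ (fglift f) (lift_is_additive f).
pose h : {additive {freeg K / R} -> A} := HB.pack_for {additive _ -> _} (fglift f) L.
move=> a x y; rewrite -[fglift f]/(h : _ -> _) raddfD; congr (_ + _).
rewrite -{2}[x]freeg_sumE -[a *: x]/(fgscale a x) /fgscale !raddf_sum.
by apply: eq_bigr => k _; rewrite /= !liftU scalerA.
Qed.

Lemma free_ind (K : choiceType) (W : {freeg K / R} -> Prop) :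
  submodule W -> (forall k, W << k >>) -> forall x, W x.
Proof.
move=> [W0 WL] Wk x; rewrite -[x]freeg_sumE; elim: (dom x) => [|k s IH].
  by rewrite big_nil.
rewrite big_cons.
suff -> : << coeff k x *g k >> = coeff k x *: << k >> :> {freeg K / R}.
  exact: WL.
by apply/eqP/freeg_eqP => z; rewrite coeffZ !coeffU mul1r.
Qed.

Lemma free_projective (K : choiceType) : projective ({freeg K / R} : lmodType R).
Proof.
move=> A B p f pS; have /choice[h ph] (k : K) := pS (f << k >>).
have [g gh] := free_lift h; exists g.
apply: free_ind => [|k]; last by rewrite /= gh ph.
by split=> [|a x y /= xE yE]; rewrite /= ?linear0 // !linearP xE yE.
Qed.

Lemma kernel_cover A B (f : {linear A -> B}) :
  exists (P : lmodType R) (g : {linear P -> A}), projective P /\ exact_at g f.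
Proof.
have [g gE] := free_lift (val : {x : A | f x == 0} -> A).
exists {freeg {x : A | f x == 0} / R}, g; split; first exact: free_projective.
move=> y; split=> [/eqP y0|[x <-]]; first by exists << Sub y y0 >>; rewrite gE.
move: x; apply: free_ind => [|k]; last by rewrite gE; exact/eqP/(valP k).
split=> [|a x y' xE yE]; first by rewrite !linear0.
by rewrite !linearP xE yE scaler0 addr0.
Qed.

(** [Ext1_vanishes] quantifies over all resolutions, so drawing a consequence from it requires one.
    It is built by repeatedly covering the kernel of the last map by a free module. *)
Lemma projective_resolution_exists T : inhabited (projective_resolution T).
Proof.
have cover A B (f : {linear A -> B}) :
    {P : lmodType R & {g : {linear P -> A} | projective P /\ exact_at g f}}.
  by have /cid[P /cid gP] := kernel_cover f; exists P.
pose st := {A : lmodType R & {B : lmodType R & {linear A -> B}}}.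
pose next (s : st) : st :=
  existT _ (projT1 (cover _ _ (projT2 (projT2 s))))
    (existT _ (projT1 s) (sval (projT2 (cover _ _ (projT2 (projT2 s)))))).
have nextP (s : st) : projective (projT1 (next s)) /\
    exact_at (projT2 (projT2 (next s))) (projT2 (projT2 s)).
  exact: (svalP (projT2 (cover _ _ (projT2 (projT2 s))))).
(* The kernel of the zero map on [T] is all of [T], so the first cover is the augmentation; this is
   why the indices of [s] are shifted below. *)
pose s0 : st := existT _ T (existT _ T (@GRing.null_fun T T : {linear T -> T})).
pose s n := iter n next s0.
pose P n := projT1 (s n.+1).
pose d n : {linear P n.+1 -> P n} := projT2 (projT2 (s n.+2)).
pose e : {linear P 0%N -> T} := projT2 (projT2 (s 1%N)).
constructor; apply: (@ProjectiveResolution R T P d e).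
- by move=> n; case: (nextP (s n)).
- by move=> y; apply/(nextP s0).2.
- exact: (nextP (s 1%N)).2.
- by move=> n; exact: (nextP (s n.+2)).2.
Qed.

(** This is exactness of Hom(B, M) -> Hom(ker p, M) -> Ext^1(T, M), obtained by transfer from a
    projective resolution of [T]. *)
Lemma Ext1_kernel_extends B T (p : {linear B -> T}) M :
  surjective p -> Ext1_vanishes T M -> kernel_extends p M.
Proof.
have [P] := projective_resolution_exists T => pS /(_ P)/H1_Hom_vanishesP.
by apply: kernel_extends_transfer => //; [apply: pr_projective | apply: pr_aug_surj].
Qed.

Lemma kernel_extends_Ext1 B T (p : {linear B -> T}) M :
  projective B -> surjective p -> kernel_extends p M -> Ext1_vanishes T M.
Proof.
move=> Bp pS Hp P; apply/H1_Hom_vanishesP.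
by apply: kernel_extends_transfer Hp => //; apply: pr_aug_surj.
Qed.

End Resolution.

(** * Quotient modules *)

Section Quotient.
Variable R : comNzRingType.
Implicit Types A B C M T : lmodType R.

Lemma quotient_exists A (W : A -> Prop) : submodule W ->
  exists (T : lmodType R) (p : {linear A -> T}),
    surjective p /\ forall x, p x = 0 <-> W x.
Proof.
move=> [W0 WL]; pose I : {pred A} := [pred x | `[< W x >]].
have WZ a x : W x -> W (a *: x) by move=> Wx; rewrite -[_ *: _]addr0; apply: WL.
have IB : zmod_closed I.
  split=> [|x y /asboolP Wx /asboolP Wy]; apply/asboolP => //.
  by rewrite addrC -scaleN1r; apply: WL.
pose J : zmodClosed A :=
  HB.pack_for (zmodClosed A) I (GRing.isZmodClosed.Build A I IB).
pose T := Quotient.quot J.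
have piE (x y : A) : (\pi_T x = \pi_T y)%qT <-> W (x - y).
  split=> [/eqP|Wxy]; first by rewrite -Quotient.idealrBE => /asboolP.
  by apply/eqP; rewrite -Quotient.idealrBE; apply/asboolP.
(* Scalars act through representatives; stability of [W] under scaling makes this compatible with
   the projection. *)
have [scale scaleE] : exists scale : R -> T -> T,
    forall a (x : A), scale a (\pi_T x)%qT = (\pi_T (a *: x))%qT.
  exists (fun a t => \pi_T (a *: repr t))%qT => a x.
  by apply/piE; rewrite -scalerBr; apply: WZ; apply/piE; rewrite reprK.
have pD (x y : A) : (\pi_T (x + y) = \pi_T x + \pi_T y)%qT by rewrite raddfD.
have sA a b t : scale a (scale b t) = scale (a * b) t.
  by rewrite -[t]reprK !scaleE scalerA.
have s1 : left_id 1 scale by move=> t; rewrite -[t]reprK scaleE scale1r.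
have sDr : right_distributive scale +%R.
  by move=> a t u; rewrite -[t]reprK -[u]reprK -pD !scaleE scalerDr pD.
have sDl t : {morph scale^~ t : a b / a + b}.
  by move=> a b; rewrite -[t]reprK !scaleE scalerDl pD.
pose TL := GRing.Zmodule_isLmodule.Build R T sA s1 sDr sDl.
pose T' : lmodType R := HB.pack_for (lmodType R) T TL.
have /linear_exists[p pE] : linear ((\pi_T)%qT : A -> T').
  by move=> a x y; rewrite pD -scaleE.
exists T', p; split=> [t|x]; first by exists (repr (t : T)); rewrite pE reprK.
rewrite pE -[X in _ <-> W X]subr0 -piE.
by rewrite -[X in _ <-> _ = X]/(\pi_T (0 : A))%qT raddf0.
Qed.

(** Only Ext^1(B / dom Q, M) matters for extending [Q]; the quotient enters through an arbitrary
    surjection with kernel dom Q. *)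
Lemma Ext1_extends B M (Q : B -> M -> Prop) : partial_linear Q ->
  (forall T (p : {linear B -> T}), surjective p ->
    (forall x, (exists y, Q x y) <-> p x = 0) -> Ext1_vanishes T M) ->
  exists g : {linear B -> M}, extends Q g.
Proof.
move=> QP HT.
have /quotient_exists[T [p [pS pE]]] : submodule (fun x => exists y, Q x y).
  case: QP => Q0 QL _; split=> [|a x x' [y Qy] [y' Qy']]; first by exists 0.
  by exists (a *: y + y'); apply: QL.
have pQ x : (exists y, Q x y) <-> p x = 0 by rewrite pE.
by apply: (Ext1_kernel_extends pS (HT _ _ pS pQ)).
Qed.

Lemma partial_linear_injective M :
  (forall B (Q : B -> M -> Prop), partial_linear Q ->
     exists g : {linear B -> M}, extends Q g) -> injective_module M.
Proof.
move=> MP A B i f iI; have [|g gQ] := MP B (fun b y => exists2 a, i a = b & f a = y).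
  split=> [|a _ _ _ _ [x <- <-] [y <- <-]|y [a a0 <-]].
    by exists 0; rewrite linear0.
    by exists (a *: x + y); rewrite linearP.
  by rewrite (_ : a = 0) ?linear0 //; apply: iI; rewrite a0 linear0.
by exists g => a; rewrite /= -(gQ _ (f a)) //; exists a.
Qed.

End Quotient.

(** * Baer's criterion *)

Section Baer.
Import classical_sets.
Variable R : comNzRingType.
Implicit Types B M : lmodType R.

Lemma Baer_criterion M :
  (forall Q : R^o -> M -> Prop, partial_linear Q ->
     exists z, forall r y, Q r y -> y = r *: z) ->
  forall B (Q : B -> M -> Prop), partial_linear Q ->
    exists g : {linear B -> M}, extends Q g.
Proof.
move=> MB B Q QP.
(* Zorn's lemma is applied to the pairs added to [Q]. Since [Q] is joined to [X], the empty chain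
   causes no trouble: its union is empty and leaves [Q] itself. *)
pose good (X : set (B * M)) := partial_linear (fun b y => Q b y \/ X (b, y)).
have [F Fgood Ftot|X [XP Xmax]] := @Zorn_bigcup _ good.
- have Fex b y b' y' : Q b y \/ (\bigcup_(X in F) X)%classic (b, y) ->
      Q b' y' \/ (\bigcup_(X in F) X)%classic (b', y') ->
      exists X : set (B * M), [/\ good X, (X `<=` \bigcup_(X in F) X)%classic,
         Q b y \/ X (b, y) & Q b' y' \/ X (b', y')].
    have sub X : F X -> (X `<=` \bigcup_(X in F) X)%classic by move=> FX c; exists X.
    case=> [Qb|[X FX Xb]] [Qb'|[X' FX' Xb']].
    + exists set0; split; [|by []|by left|by left].
      have [Q0 QL QF] := QP; split; first by left.
        by move=> a x z x' z' [Qx|[]] [Qx'|[]]; left; apply: QL.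
      by move=> z [/QF|[]].
    + by exists X'; split; [apply: Fgood|apply: sub|left|right].
    + by exists X; split; [apply: Fgood|apply: sub|right|left].
    + have [XX'|X'X] := Ftot _ _ FX FX'.
        by exists X'; split; [apply: Fgood|apply: sub|right; apply: XX'|right].
      by exists X; split; [apply: Fgood|apply: sub|right|right; apply: X'X].
  split.
  + by left; case: QP.
  + move=> a x y x' y' Qx Qx'; have [X [[_ XL _] XF Xx Xx']] := Fex _ _ _ _ Qx Qx'.
    by case: (XL a _ _ _ _ Xx Xx') => [|/XF]; [left | right].
  + by move=> y Qy; have [X [[_ _ X0] _ /X0]] := Fex _ _ _ _ Qy Qy.
pose P b y := Q b y \/ X (b, y).
have [b|g Pg] := partial_linear_total XP; last first.
  by exists g => x y Qxy; apply: (partial_linear_fun XP) (Pg x); left.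
have [P0 PL PF] := XP.
(* The r with r b in the domain form an ideal; the hypothesis on ideals gives a value [z] for [b]
   that is compatible with [P]. Adding it contradicts maximality. *)
have [|z zP] := MB (fun r => P (r *: b)).
  split=> [|a x y x' y' Px Px'|y]; rewrite ?scale0r //; last exact: PF.
  by rewrite scalerDl -scalerA; apply: PL.
pose X' : set (B * M) := [set c |
  exists r x y, [/\ P x y, c.1 = x + r *: b & c.2 = y + r *: z]]%classic.
have QX' x y : Q x y \/ X' (x, y) -> X' (x, y).
  by case=> // Qx; exists 0, x, y; rewrite !scale0r !addr0; split=> //; left.
apply: contrapT => nb; apply: (Xmax X'); last first.
  split.
  - by left; case: QP.
  - move=> a _ _ _ _ /QX'[/= r [x [y [Px -> ->]]]] /QX'[/= r' [x' [y' [Px' -> ->]]]].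
    right; exists (a * r + r'), (a *: x + x'), (a *: y + y').
    split; [exact: PL| |]; rewrite /= !scalerDr !scalerDl !scalerA.
      by rewrite (addrACA (a *: x)).
    by rewrite (addrACA (a *: y)).
  - move=> _ /QX'[/= r [x [y [Px /esym/eqP + ->]]]]; rewrite addrC addr_eq0.
    move=> /eqP rb; have /zP <- : P (r *: b) (- y).
      by rewrite rb -!scaleN1r; apply: (partial_linearZ (-1) XP).
    by rewrite subrr.
split=> [[x y] Xx|/(_ (b, z)) X'X].
  by exists 0, x, y; rewrite !scale0r !addr0; split=> //; right.
apply: nb; exists z; right; apply: X'X.
by exists 1, 0, 0; rewrite !scale1r !add0r.
Qed.

End Baer.

(** * The injective cogenerator Q/Z of abelian groups *)

Section IntegerModules.
Import Order.TTheory Num.Theory.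

Lemma int_submodule_principal (D : int^o -> Prop) : submodule D ->
  exists d : int, forall k, D k <-> exists q : int, k = q * d.
Proof.
move=> [D0 DL].
have DZ a x : D x -> D (a * x) by move=> Dx; rewrite -[_ * _]addr0; apply: DL.
(* The generator is the least positive element if there is one, and 0 otherwise. *)
have [[n /asboolP/andP[n0 /asboolP Dn]]|D_triv] :=
    pselect (exists n : nat, `[< (0 < n)%N && `[< D n%:Z >] >]).
  have : exists n : nat, (0 < n)%N && `[< D n%:Z >].
    by exists n; rewrite n0; apply/asboolP.
  move=> /ex_minnP[m /andP[m0 /asboolP Dm] m_min]; exists m%:Z => k.
  split=> [Dk|[q ->]]; last exact: DZ.
  exists (k %/ m%:Z)%Z.
  rewrite [LHS](divz_eq k m%:Z) (_ : (k %% m%:Z)%Z = 0) ?addr0 //.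
  have m0Z : m%:Z != 0 by rewrite -lt0n.
  have := modz_ge0 k m0Z; have := ltz_mod k m0Z.
  have : D (k %% m%:Z)%Z.
    by rewrite /modz addrC -mulNr; apply: DL.
  case: (_ %% _)%Z => // -[|r] // Dr; rewrite ltz_nat => rm _.
  by have := m_min r.+1; rewrite asboolT //= leqNgt rm => /(_ isT).
exists 0 => k; split=> [Dk|[q ->]]; last by rewrite mulr0.
exists 0; rewrite mulr0; apply: contrapT => k0; apply: D_triv; exists `|k|%N.
apply/asboolP/andP; split; first by rewrite absz_gt0; apply/eqP.
by apply/asboolP; rewrite abszE normrEsg; apply: DZ.
Qed.

(** Q/Z is injective by Baer's criterion, because it is divisible. It is a cogenerator: if D = dZ is
    proper, the class of 1/d is nonzero and killed by D. *)
Lemma int_injective_cogenerator_exists : exists G : lmodType int,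
  (forall (B : lmodType int) (Q : B -> G -> Prop), partial_linear Q ->
     exists g : {linear B -> G}, extends Q g) /\
  (forall D : int^o -> Prop, submodule D -> ~ D 1 ->
     exists2 z : G, z <> 0 & forall k, D k -> k *: z = 0).
Proof.
have [|G [p [pS pE]]] :=
    @quotient_exists int (zmodule rat) (fun x => (x : rat) \is a Num.int).
  split=> [|a x y xZ yZ]; first exact: rpred0.
  by rewrite /= scalezrE; apply: rpredD => //; apply: rpredMz.
have inv (d : int) (x : zmodule rat) : d != 0 -> d *: p (d%:~R^-1 * x : rat) = p x.
  move=> d0; rewrite -linearZ /= scalezrE -mulrzl mulrA mulfV ?mul1r //.
  by rewrite intr_eq0.
exists G; split=> [B|D DS D1].
  apply: Baer_criterion => Q QP.
  have [|d dE] := @int_submodule_principal (fun r => exists y, Q r y).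
    case: QP => Q0 QL _; split=> [|a x x' [y Qy] [y' Qy']]; first by exists 0.
    by exists (a *: y + y'); apply: QL.
  have /dE[y0 Qd] : exists q : int, d = q * d by exists 1; rewrite mul1r.
  have [z zE] : exists z, y0 = d *: z.
    have [d0|d0] := eqVneq d 0.
      by exists 0; rewrite scaler0; rewrite d0 in Qd; case: QP => _ _; apply.
    by have [x <-] := pS y0; exists (p (d%:~R^-1 * x : rat)); rewrite inv.
  exists z => r y Qr; have /dE[q rE] : exists y, Q r y by exists y.
  rewrite rE -scalerA -zE; apply: (partial_linear_fun QP Qr); rewrite rE.
  exact: (partial_linearZ q QP Qd).
have [d dE] := int_submodule_principal DS.
(* For D = 0 any nonzero class will do; the class of 1/2 is taken. *)
pose c : int := if d == 0 then 2 else d.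
have c0 : c != 0 by rewrite /c; case: ifP => // ->.
exists (p (c%:~R^-1 * 1 : rat)) => [/pE|k /dE[q ->]].
  rewrite mulr1 => /intrP[m mE]; have {mE}/eqP : m * c = 1.
    by apply: (@intr_inj rat); rewrite intrM -mE mulVf // intr_eq0.
  rewrite /c; case: ifP => [_|_ /eqP mE]; last by apply: D1; apply/dE; exists m.
  by case: m => // -[|m].
have [->|d0] := eqVneq d 0; first by rewrite mulr0 scale0r.
have -> : d = c by rewrite /c (negbTE d0).
by rewrite -scalerA inv // (pE 1).2 ?scaler0 // rpred1.
Qed.

End IntegerModules.

(** * Coinduced modules *)

Section Coinduced.
Variable R : comNzRingType.

(** [E] consists of the additive maps R -> G vanishing on [I], with (a e)(r) = e(r a); the condition
    on [I] makes this set stable under the action. [E] is accessed only through the evaluation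
    [ev]. *)
Lemma coinduced_module (G : zmodType) (I : R -> Prop) :
  (forall a r, I r -> I (r * a)) ->
  exists (E : lmodType R) (ev : E -> R -> G),
  [/\ forall e e', ev e =1 ev e' -> e = e',
      forall e, {morph ev e : r s / r + s},
      forall e r, I r -> ev e r = 0,
      forall a e e' r, ev (a *: e + e') r = ev e (r * a) + ev e' r &
      forall f : R -> G, {morph f : r s / r + s} ->
        (forall r, I r -> f r = 0) -> exists e, ev e = f].
Proof.
move=> IM.
pose P (f : R -> G) := {morph f : r s / r + s} /\ forall r, I r -> f r = 0.
pose T := {f : R -> G | `[< P f >]}.
have TP (e : T) : P (val e) by have /asboolP := valP e.
have TE (e e' : T) : val e =1 val e' -> e = e' by move=> /funext; apply: val_inj.
have mk f : P f -> {e : T | val e = f} by move=> /asboolT Pf; exists (Sub f Pf).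
have [zero zeroE] : {e : T | val e = fun=> 0}.
  by apply: mk; split=> // r s; rewrite addr0.
have [opp oppE] : {o : T -> T | forall e, val (o e) = fun r => - val e r}.
  suff o (e : T) : {e' : T | val e' = fun r => - val e r}.
    by exists (fun e => sval (o e)) => e; apply: (svalP (o e)).
  have [eD eI] := TP e; apply: mk; split=> [r s|r /eI->]; last exact: oppr0.
  by rewrite eD opprD.
have [add addE] : {o : T -> T -> T |
    forall e e', val (o e e') = fun r => val e r + val e' r}.
  suff o (e e' : T) : {e'' : T | val e'' = fun r => val e r + val e' r}.
    by exists (fun e e' => sval (o e e')) => e e'; apply: (svalP (o e e')).
  have [eD eI] := TP e; have [eD' eI'] := TP e'.
  apply: mk; split=> [r s|r Ir]; last by rewrite eI // eI' // addr0.
  by rewrite eD eD' addrACA.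
have [scale scaleE] : {o : R -> T -> T |
    forall a e, val (o a e) = fun r => val e (r * a)}.
  suff o a (e : T) : {e' : T | val e' = fun r => val e (r * a)}.
    by exists (fun a e => sval (o a e)) => a e; apply: (svalP (o a e)).
  have [eD eI] := TP e; apply: mk; split=> [r s|r Ir]; last exact/eI/IM.
  by rewrite mulrDl eD.
have aA : associative add by move=> x y z; apply: TE => r; rewrite !addE addrA.
have aC : commutative add by move=> x y; apply: TE => r; rewrite !addE addrC.
have a0 : left_id zero add by move=> x; apply: TE => r; rewrite addE zeroE add0r.
have aN : left_inverse zero opp add.
  by move=> x; apply: TE => r; rewrite addE oppE zeroE addNr.
pose ZM := GRing.isZmodule.Build T aA aC a0 aN.
pose Z : zmodType := HB.pack_for zmodType T ZM.
have sA a b (t : Z) : scale a (scale b t) = scale (a * b) t.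
  by apply: TE => r; rewrite !scaleE mulrA.
have s1 : left_id 1 (scale : R -> Z -> Z).
  by move=> t; apply: TE => r; rewrite scaleE mulr1.
have sDr : right_distributive (scale : R -> Z -> Z) +%R.
  by move=> a t u; apply: TE => r; rewrite scaleE !addE !scaleE.
have sDl (t : Z) : {morph (scale : R -> Z -> Z)^~ t : a b / a + b}.
  move=> a b; apply: TE => r; rewrite scaleE addE !scaleE mulrDr.
  by have [eD _] := TP t.
pose LM := GRing.Zmodule_isLmodule.Build R Z sA s1 sDr sDl.
pose E : lmodType R := HB.pack_for (lmodType R) T ZM LM.
exists E, (fun e => val (e : T)); split=> //.
- by move=> e; case: (TP e).
- by move=> e; case: (TP e).
- by move=> a e e' r; rewrite addE scaleE.
- by move=> f fD fI; have [e eE] := mk f (conj fD fI); exists e.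
Qed.
End Coinduced.

(** * Phi-rings: a nonnil-injective module that is not FP-injective *)

Section PhiRing.
Variable R : comNzRingType.
Implicit Types A B C M T : lmodType R.
Local Notation N := (@nil_ideal R).

Lemma nil_divided : phi_ring R -> forall s x, s \in N ->
  x \notin N -> exists2 t, t \in N & s = t * x.
Proof.
move=> [[_ Nprime] Ndiv] s x Ns Nx.
have /asboolP[t sE] := (Ndiv x Nx).1 s Ns; exists t => //.
by move: Ns; rewrite sE => /Nprime; rewrite (negbTE Nx) orbF.
Qed.

Lemma phi_torsionI T :
  (forall x : T, exists2 a, a \notin N & a *: x = 0) -> phi_torsion T.
Proof.
move=> tT x; have [a aN ax] := tT x.
exists ([pred b | `[< b *: x = 0 >]] : {pred R}); split; last by move=> b /asboolP.
split; last by exists a => //; apply/asboolP.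
split=> [|b u v /asboolP u0 /asboolP v0]; apply/asboolP; first by rewrite scale0r.
by rewrite scalerDl -scalerA u0 v0 scaler0 addr0.
Qed.

(** [E] is coinduced from [G] along R / Nil(R). The last clause turns an additive map [g] into an
    element of [E], whose value at 1 is g 1 and whose annihilator contains every [a] with g(R a) =
    0. *)
Lemma nonnil_injective_coinduced (G : lmodType int) : phi_ring R ->
  (forall (B : lmodType int) (Q : B -> G -> Prop), partial_linear Q ->
     exists g : {linear B -> G}, extends Q g) ->
  exists E : lmodType R, [/\ nonnil_injective E,
    forall s (e : E), s \in N -> s *: e = 0 &
    forall g : R -> G, {morph g : r s / r + s} ->
      (forall s, s \in N -> g s = 0) ->
    exists2 z : E, (z = 0 -> g 1 = 0) &
      forall a, (forall r, g (r * a) = 0) -> a *: z = 0].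
Proof.
move=> phiR Ginj; have [[[N0 N1 NL] Nprime] _] := phiR.
have NM a s : s \in N -> a * s \in N.
  by move=> Ns; rewrite -[_ * _]addr0; apply: NL.
have [|E [ev [evI evD evN evL evE]]] :=
    @coinduced_module R G (fun r => r \in N).
  by move=> a r; rewrite mulrC; apply: NM.
have ev0 r : ev 0 r = 0.
  have := evL 1 0 0 r; rewrite scale1r addr0 mulr1 => /eqP.
  by rewrite -subr_eq0 opprD addrA subrr add0r oppr_eq0 => /eqP.
have evZ a e r : ev (a *: e) r = ev e (r * a).
  by have := evL a e 0 r; rewrite addr0 ev0 addr0.
have EN s (e : E) : s \in N -> s *: e = 0.
  by move=> Ns; apply: evI => r; rewrite evZ ev0 evN // NM.
exists E; split=> //; last first.
  move=> g gD gN; have [z zE] := evE g gD gN.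
  exists z => [z0|a ga]; first by rewrite -zE z0 ev0.
  by apply: evI => r; rewrite evZ ev0 zE.
move=> T tT P; apply/H1_Hom_vanishesP.
move: (pr_mod P 0) (pr_aug P) => B p Q QP Qdom.
(* Some non-nilpotent x kills p b, so [Q] is defined at x b. Writing s = t x with t nilpotent, its
   value at s b lies in t E = 0. *)
have QN s b : s \in N -> Q (s *: b) 0.
  move=> Ns; have [I [[_ [x Ix Nx]] Ip]] := tT (p b).
  have [t Nt ->] := nil_divided phiR Ns Nx.
  have /Qdom[e Qe] : p (x *: b) = 0 by rewrite linearZ /= Ip.
  by rewrite -scalerA -(EN t e Nt); apply: partial_linearZ.
(* [Q] followed by evaluation at 1, as a partial map of abelian groups. *)
pose Gam (b : zmodule B) y := exists2 e, Q b e & y = ev e 1.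
have evz e (k : int) r : ev e (r *~ k) = ev e r *~ k.
  pose L := GRing.isNmodMorphism.Build R G (ev e) (conj (evN e 0 N0) (evD e)).
  exact: (raddfMz (HB.pack_for {additive R -> G} (ev e) L : {additive R -> G})).
have GamP : partial_linear Gam.
  have [Q0 QL QF] := QP; split.
  - by exists 0.
  - move=> a x _ x' _ [e Qe ->] [e' Qe' ->]; exists (a%:~R *: e + e').
      by rewrite /= scalezrE -scaler_int; apply: QL.
    by rewrite evL mul1r evz -scaler_int intz.
  - by move=> _ [e /QF -> ->].
have [g gE] := Ginj _ _ GamP.
have gN s b : s \in N -> g (s *: b) = 0.
  by move=> Ns; rewrite -(gE _ 0) //; exists 0; [apply: QN | rewrite ev0].
(* The adjunction turns the additive extension [g] into the R-linear map sending b to r |-> g(r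
   b). *)
have /choice[h hE] (b : B) : exists e, ev e = fun r => g (r *: b).
  by apply: evE => [r s|s Ns]; [rewrite scalerDl [LHS]raddfD | apply: gN].
have /linear_exists[H HE] : linear h.
  move=> a b b'; apply: evI => r; rewrite evL !hE.
  by rewrite -scalerA scalerDr [LHS]raddfD.
exists H => b e Qbe; rewrite HE; apply: evI => r; rewrite hE.
apply/gE; exists (r *: e); last by rewrite evZ mul1r.
exact: partial_linearZ.
Qed.

Lemma nonnil_injective_not_FP_injective (n : R) : phi_ring R ->
  n \in N -> n != 0 ->
  exists2 E : lmodType R, nonnil_injective E & ~ FP_injective E.
Proof.
move=> phiR Nn n0; have [[[N0 N1 NL] Nprime] _] := phiR.
have NM a s : s \in N -> a * s \in N.
  by move=> Ns; rewrite -[_ * _]addr0; apply: NL.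
have [G [Ginj Gchar]] := int_injective_cogenerator_exists.
have [E [Einj EN Ez]] := nonnil_injective_coinduced phiR Ginj.
exists E => // FPE.
(* J = Ann(n) + Nil(R). *)
pose J (r : R^o) := exists a s, [/\ a * n = 0, s \in N & r = a + s].
have [J0 JL] : submodule J.
  split; first by exists 0, 0; rewrite mul0r addr0.
  move=> b _ _ [a [s [an Ns ->]]] [a' [s' [an' Ns' ->]]].
  exists (b * a + a'), (b * s + s'); split; last 1 first.
  - by rewrite scalerDr addrACA.
  - by rewrite mulrDl -mulrA an an' mulr0 addr0.
  - exact: NL.
have JZ b r : J r -> J (b * r).
  by move=> Jr; rewrite -[b * r]addr0; apply: JL.
(* If 1 = a + s with a n = 0 and s nilpotent, then n = s n = s^k n = 0. *)
have J1 : ~ J 1.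
  move=> [a [s [an /asboolP[k sk] aE]]].
  have nE : n = s * n by rewrite -[LHS]mul1r aE mulrDl an add0r.
  have {}nE : n = s ^+ k * n.
    by elim: k {sk} => [|k IH]; rewrite ?mul1r // exprSr -mulrA -nE.
  by move/eqP: n0; apply; rewrite nE sk mul0r.
have [||y y0 yJ] := Gchar (fun k : int => J k%:~R).
- by split=> // a k l Jk Jl; rewrite intrD intrM; apply: JL.
- by [].
(* On J + Z 1 this kills J and sends 1 to [y]. It is well defined because [y] is killed by the
   integers lying in J. Its extension [g] to R provides the element [z]. *)
pose Gam (r : zmodule R) x := exists2 k : int, J (r - k%:~R) & x = k *: y.
have [|g gE] := Ginj _ Gam.
  split.
  - by exists 0; rewrite ?subr0 ?scale0r.
  - move=> a r _ r' _ [k Jk ->] [k' Jk' ->]; exists (a * k + k').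
      rewrite intrD intrM opprD addrACA -mulrN /= scalezrE -mulrzl -mulrDr.
      exact: JL.
    by rewrite scalerDl scalerA.
  - move=> _ [k Jk ->]; apply: yJ; have := JZ (-1) _ Jk.
    by rewrite sub0r mulN1r opprK.
have gJ r : J r -> g r = 0.
  by move=> Jr; rewrite -(gE r 0) //; exists 0; rewrite ?subr0 ?scale0r.
have g1 : g (1 : R) = y.
  by rewrite -(gE _ y) //; exists 1; rewrite ?subrr ?scale1r.
have [||z z0 gz] := Ez g; first by move=> r s; apply: (raddfD g r s).
  by move=> s Ns; apply: gJ; exists 0, s; rewrite mul0r add0r.
have {gz} nz a : a * n = 0 -> a *: z = 0.
  move=> an; apply: gz => r; apply/gJ/JZ; exists a, 0.
  by rewrite addr0.
(* T = R / nR, with R written as row vectors of length 1 so that its finite presentation is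
   immediate. *)
have [|T [p [pS pE]]] := @quotient_exists R 'rV[R]_1 (fun v => exists w, n *: w = v).
  split=> [|a _ _ [v <-] [w <-]]; first by exists 0; rewrite scaler0.
  by exists (a *: v + w); rewrite scalerDr !scalerA mulrC.
have fpT : finitely_presented T.
  by exists 1%N, 1%N, (n \*: idfun), p; split=> // v; rewrite pE.
(* The map nR -> E sending n to [z]; it is well defined because Ann(n) kills [z]. *)
pose Q (v : 'rV[R]_1) x := exists w : 'rV[R]_1, n *: w = v /\ x = w 0 0 *: z.
have QP : partial_linear Q.
  split.
  - by exists 0; rewrite scaler0 mxE scale0r.
  - move=> a _ _ _ _ [v [<- ->]] [w [<- ->]]; exists (a *: v + w).
    by rewrite !mxE scalerDl !scalerDr !scalerA mulrC.
  - move=> _ [w [/rowP/(_ 0) + ->]]; rewrite !mxE => nw; apply: nz.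
    by rewrite mulrC.
have [|g' g'E] := Ext1_kernel_extends pS (FPE T fpT) QP.
  move=> v; rewrite pE; split=> [[_ [w [<- _]]]|[w <-]]; first by exists w.
  by exists (w 0 0 *: z), w.
apply: y0; rewrite -g1; apply: z0.
(* An extension [g'] would give z = n g'(1), which is 0 because n E = 0. *)
rewrite -[z]scale1r (g'E (n *: const_mx 1) (1 *: z)).
  by rewrite linearZ /= EN.
by exists (const_mx 1); rewrite mxE.
Qed.

End PhiRing.

(** * Integral domains *)

Section Domain.
Variable R : comNzRingType.
Implicit Types A B C M T : lmodType R.

Lemma rV_projective n : projective ('rV[R]_n : lmodType R).
Proof.
move=> A B p f pS; have /choice[h ph] (j : 'I_n) := pS (f (delta_mx 0 j)).
have [|g gE] := @linear_exists R _ _ (fun v : 'rV[R]_n => \sum_j v 0 j *: h j).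
  move=> a v w; rewrite scaler_sumr -big_split; apply: eq_bigr => j _.
  by rewrite !mxE scalerDl scalerA.
exists g => v; rewrite /= gE [in RHS](row_sum_delta v) !linear_sum.
by apply: eq_bigr => j _; rewrite !linearZ /= ph.
Qed.

Lemma surjective_factor A B C (q : {linear A -> B}) (h : {linear A -> C}) :
  surjective q -> (forall x, q x = 0 -> h x = 0) ->
  exists h' : {linear B -> C}, forall x, h' (q x) = h x.
Proof.
move=> /choice[s qs] hq.
have hE x x' : q x = q x' -> h x = h x'.
  move=> xx'; apply/eqP; rewrite -subr_eq0 -linearB hq // linearB /= xx'.
  exact: subrr.
have [|h' h'E] := @linear_exists R _ _ (h \o s).
  by move=> a x y; rewrite /= -linearP; apply: hE; rewrite linearP !qs.
by exists h' => x; rewrite h'E; apply: hE; rewrite qs.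
Qed.

(** A cocycle on P_1 factors through P_1 / ker d_0, which embeds in P_0, so injectivity extends it
    to P_0. *)
Lemma injective_module_Ext1 M T : injective_module M -> Ext1_vanishes T M.
Proof.
move=> Minj P f fd.
have ex1 y : pr_diff P 0 y = 0 <-> exists x, pr_diff P 1 x = y.
  exact: pr_exactS.
have [|U [q [qS qE]]] := @quotient_exists R _ (fun x => pr_diff P 0 x = 0).
  by split=> [|a x y x0 y0]; rewrite ?linear0 // linearP x0 y0 scaler0 addr0.
have [x /qE//|i iE] := surjective_factor (h := pr_diff P 0) qS.
have [x /qE/ex1[y <-]|f' f'E] := surjective_factor (h := f) qS; first exact: fd.
have [|g gE] := Minj _ _ i f'.
  move=> t u; have [x <-] := qS t; have [y <-] := qS u; rewrite !iE => xy.
  apply/eqP; rewrite -subr_eq0 -linearB; apply/eqP/qE.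
  by rewrite linearB /= xy subrr.
by exists g => x; rewrite /= -iE -[LHS]/((g \o i) (q x)) gE.
Qed.

Hypothesis domR : GRing.integral_domain_axiom R.

Lemma domain_nilP (x : R) : (x \in @nil_ideal R) = (x == 0).
Proof.
apply/idP/eqP => [/asboolP[k]|->]; last by apply/asboolP; exists 1%N; rewrite expr1.
elim: k => [|k IH]; first by move/eqP; rewrite expr0 oner_eq0.
by rewrite exprS => /domR/orP[/eqP|/eqP/IH].
Qed.

Lemma domain_nonnil_injective M : nonnil_injective M -> injective_module M.
Proof.
move=> Minj; apply: partial_linear_injective; apply: Baer_criterion => Q QP.
(* A nonzero r0 in dom Q kills R / dom Q, which is therefore phi-torsion. If dom Q = 0, then z = 0
   serves. *)
have [[r0 [y0 [Q0 r00]]]|triv] := pselect (exists r y, Q r y /\ r <> 0).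
  have [|g gQ] := Ext1_extends QP.
    move=> T p pS pQ; apply: Minj; apply: phi_torsionI => t.
    exists r0; first by rewrite domain_nilP; apply/eqP.
    have [r <-] := pS t; have /pQ pr0 : exists y, Q r0 y by exists y0.
    have rC : r0 *: r = r *: r0 := mulrC (r0 : R) r.
    by rewrite -linearZZ rC linearZZ pr0 scaler0.
  exists (g 1) => r y Qr; rewrite -linearZ /= [_ *: _]mulr1.
  exact: gQ.
exists 0 => r y Qr; rewrite scaler0; case: QP => _ _; apply.
by have [<-|/eqP r0] := eqVneq r 0 => //; case: triv; exists r, y.
Qed.

Lemma domain_nonnil_FP_injective M : nonnil_FP_injective M -> FP_injective M.
Proof.
move=> Minj N [m [n [d [p [dp pS]]]]].
apply: kernel_extends_Ext1 (@rV_projective n) pS _ => Q QP Qdom.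
have [Q0 QL QF] := QP.
pose supp (S : {set 'I_n}) (v : 'rV[R]_n) := forall j, j \notin S -> v 0 j = 0.
(* The span R^S of the basis vectors in [S] meets K = ker p trivially; [S] is then taken maximal. *)
pose indep (S : {set 'I_n}) := `[< forall v, supp S v -> p v = 0 -> v = 0 >].
have indep0 : indep set0.
  by apply/asboolP => v v0 _; apply/rowP => j; rewrite v0 ?inE // mxE.
have [S /maxsetP[/asboolP Sind Smax] _] := maxset_exists indep0.
have suppL a v w : supp S v -> supp S w -> supp S (a *: v + w).
  by move=> Sv Sw j jS; rewrite !mxE Sv // Sw // mulr0 addr0.
(* The extension of [Q] by zero to K + R^S. *)
pose Q' v y := exists k w, [/\ v = k + w, supp S w & Q k y].
have Q'P : partial_linear Q'.
  split.
  - by exists 0, 0; split; rewrite ?addr0 // => j _; rewrite mxE.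
  - move=> a _ y _ y' [k [w [-> Sw Qk]]] [k' [w' [-> Sw' Qk']]].
    exists (a *: k + k'), (a *: w + w'); split; [|exact: suppL|exact: QL].
    by rewrite scalerDr addrACA.
  - move=> y [k [w [/esym/eqP + Sw Qk]]]; rewrite addr_eq0 => /eqP kE.
    have pk : p k = 0 by apply/Qdom; exists y.
    suff w0 : w = 0 by apply: QF; move: Qk; rewrite kE w0 oppr0.
    by apply: Sind => //; rewrite -[w]opprK -kE linearN /= pk oppr0.
have [|g gQ] := Ext1_extends Q'P; last first.
  exists g => x y Qx; apply: gQ; exists x, 0; split; rewrite ?addr0 // => j _.
  by rewrite mxE.
move=> T q qS Q'dom; apply: Minj.
(* Relations presenting R^n / (K + R^S): those of [N], given by [d], and the basis vectors in [S],
   given by [mask]. *)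
- pose mask (w : 'rV[R]_n) : 'rV[R]_n := \row_j (if j \in S then w 0 j else 0).
  have [|d' d'E] := @linear_exists R 'rV[R]_(m + n) 'rV[R]_n
      (fun u => d (lsubmx u) + mask (rsubmx u)).
    move=> a u v; rewrite !linearP scalerDr addrACA; congr (_ + _).
    by apply/rowP => j; rewrite !mxE; case: ifP => // _; rewrite mulr0 addr0.
  exists (m + n)%N, n, d', q; split=> // v; rewrite -Q'dom; split.
    move=> [y [k [w [-> Sw Qk]]]]; have /dp[u uk] : p k = 0 by apply/Qdom; exists y.
    exists (row_mx u w); rewrite d'E row_mxKl row_mxKr uk; congr (_ + _).
    by apply/rowP => j; rewrite !mxE; case: ifP => // /negbT/Sw.
  move=> [u <-]; have /Qdom[y Qy] : p (d (lsubmx u)) = 0.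
    by apply/dp; exists (lsubmx u).
  exists y, (d (lsubmx u)), (mask (rsubmx u)); rewrite d'E; split=> // j jS.
  by rewrite mxE (negbTE jS).
have qS0 w : supp S w -> q w = 0.
  by move=> Sw; apply/Q'dom; exists 0, 0, w; rewrite add0r.
have qp0 k : p k = 0 -> q k = 0.
  move=> /Qdom[y Qk]; apply/Q'dom; exists y, k, 0; split; rewrite ?addr0 //.
  by move=> j _; rewrite mxE.
have /choice[c cP] (j : 'I_n) : exists c : R, c <> 0 /\ c *: q (delta_mx 0 j) = 0.
  have [jS|jS] := boolP (j \in S).
    exists 1; split; first exact/eqP/oner_neq0.
    rewrite qS0 ?scaler0 // => i iS; rewrite mxE.
    by case: (i =P j) iS => [->|_ _]; rewrite ?jS ?andbF.
  (* By maximality K contains a nonzero w supported on S and j. Its coordinate at j is nonzero,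
     since otherwise w would lie in both K and R^S; and w_j e_j lies in K + R^S. *)
  have /asboolPn/existsNP[w] : ~~ indep (j |: S).
    apply/negP => /Smax -/(_ (subsetUr _ _)) SE.
    by move: jS; rewrite -SE setU11.
  move=> /not_implyP[Sw /not_implyP[pw w0]].
  exists (w 0 j); split=> [wj|].
    apply: w0; apply: Sind => // i iS; have [->//|ij] := eqVneq i j.
    by apply: Sw; rewrite !inE negb_or ij.
  have -> : w 0 j *: q (delta_mx 0 j) = q w - q (w - w 0 j *: delta_mx 0 j).
    by rewrite -linearZ -linearB opprB addrC subrK.
  rewrite qp0 // qS0 ?subrr // => i iS; rewrite !mxE eqxx /=.
  have [->|ij] := eqVneq i j; first by rewrite mulr1 subrr.
  by rewrite mulr0 subr0; apply: Sw; rewrite !inE negb_or ij.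
(* The product of the c_j kills every generator, and is nonzero in a domain. *)
apply: phi_torsionI => t; have [v <-] := qS t; exists (\prod_j c j).
  rewrite domain_nilP; elim/big_rec: _ => [|j x _ x0]; first exact: oner_neq0.
  by apply/negP => /eqP/domR; rewrite (negbTE x0) orbF => /eqP; case: (cP j).
rewrite (row_sum_delta v) linear_sum scaler_sumr big1 // => j _ /=.
rewrite (bigD1 j) //= linearZ /= scalerA -mulrA [c j * _]mulrC -scalerA.
by rewrite (cP j).2 scaler0.
Qed.

End Domain.

Theorem theorem1p6 (R : comNzRingType) (hR : phi_ring R) :
  (GRing.integral_domain_axiom R <->
     (forall M : lmodType R, nonnil_injective M -> injective_module M)) /\
  (GRing.integral_domain_axiom R <->
     (forall M : lmodType R, nonnil_FP_injective M -> FP_injective M)).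
Proof.
(* Both converses reduce to this: each of the two conditions makes every nonnil-injective module
   FP-injective, which forces Nil(R) = 0; as Nil(R) is prime, R is then a domain. *)
have domI : (forall E : lmodType R, nonnil_injective E -> FP_injective E) ->
    GRing.integral_domain_axiom R.
  move=> FP x y xy0; have N0 z : z \in @nil_ideal R -> z == 0.
    move=> Nz; apply/negP => /negP z0.
    by have [E /FP] := nonnil_injective_not_FP_injective hR Nz z0.
  have [[_ Nprime] _] := hR.
  have /Nprime/orP[/N0->|/N0->] : x * y \in @nil_ideal R; rewrite ?orbT //.
  by apply/asboolP; exists 1%N; rewrite expr1.
split; split=> [domR M|H].
- exact: domain_nonnil_injective.
- by apply: domI => E /H Einj T _; apply: injective_module_Ext1.
- exact: domain_nonnil_FP_injective.
- by apply: domI => E Einj; apply: H => T _; apply: Einj.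
Qed.
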